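(* Let $\mathcal K$ be a flag simplicial complex of dimension $n$ with $f$-vector $(f_0,\dots,f_n)$, and set $f_i=0$ for $i>n$. Write \[ \Biggl(1+\sum_{i=0}^{n}(-1)^{i+1}f_i\frac{t^{i+1}}{(1+t)^{i+1}}\Biggr)^{-1}=1+s_1t+s_2t^2+\cdots \] as a formal power series. Then for every integer $N\ge1$ the sequence $\underline{s}=(s_1,s_2,\dots)$ satisfies $(-1)^{N+1}\sum_{d\mid N}\mu(N/d)\,p_d(\underline{s})\ge 0$. Specifically, for every integer $N\ge 1$, \[ (-1)^{N}\sum_{d\mid N}\mu(N/d)\,(-1)^d\,p_d(\underline{\alpha})\ge 0, \] where $\underline{\alpha}=(\alpha_1,\alpha_2,\dots)$ with $\alpha_m:=\sum_{i=0}^{m-1}f_i\binom{m-1}{i}$ for $m\ge1$.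
   Context: A simplicial complex $\mathcal K$ on vertex set $[m]=\{1,\dots,m\}$ is a collection of subsets of $[m]$ closed under taking subsets, containing every one-element subset; the dimension of a simplex $\sigma$ is $|\sigma|-1$, and $f_i$ is the number of $i$-dimensional simplices. A minimal non-face is a subset $\sigma\notin\mathcal K$ all of whose proper subsets lie in $\mathcal K$; $\mathcal K$ is flag if all its minimal non-faces have exactly two elements. Sums $\sum_{d\mid N}$ run over positive divisors $d$ of $N$; $\mu$ is the M\''obius function ($\mu(n)=(-1)^k$ if $n$ is a product of $k$ distinct primes, $0$ otherwise). For a sequence $\underline{x}=(x_1,x_2,\dots)$, $p_d(\underline{x})$ is the unique polynomial in $x_1,\dots,x_d$ such that whenever $x_i=\sigma_i(\gamma_1,\dots,\gamma_M)$ are the elementary symmetric polynomials in variables $\gamma_1,\dots,\gamma_M$ ($M\ge d$), $p_d(\underline{x})=\gamma_1^d+\cdots+\gamma_M^d$ (the $d$-th Newton power sum expressed in elementary symmetric polynomials; e.g. $p_1=x_1$, $p_2=x_1^2-2x_2$, $p_3=x_1^3-3x_1x_2+3x_3$). *)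

(* Defs.v *)
From HB Require Import structures.
From mathcomp Require Import all_boot all_order all_algebra.
From mathcomp Require Import mpoly.

Set Implicit Arguments.
Unset Strict Implicit.
Unset Printing Implicit Defensive.

Import Order.TTheory GRing.Theory Num.Theory.
Local Open Scope ring_scope.

(* The vertex set [m] = {1, ..., m} is 'I_m. *)
Section SimplicialComplexes.
Variable m : nat.
Implicit Types (K : {set {set 'I_m}}) (s t : {set 'I_m}).

Definition simplicial_complex K : Prop :=
  (forall s t, s \in K -> t \subset s -> t \in K) /\
  (forall i : 'I_m, [set i] \in K).

(* A simplex of dimension n has n + 1 elements. *)
Definition complex_dim K (n : nat) : Prop := (\max_(s in K) #|s| = n.+1)%N.

Definition fvec K (i : nat) : nat := #|[set s in K | #|s| == i.+1]|.

Definition minimal_nonface K s : Prop :=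
  s \notin K /\ forall t, t \proper s -> t \in K.

Definition flag K : Prop := forall s, minimal_nonface K s -> #|s| = 2%N.

End SimplicialComplexes.

Definition mobius (n : nat) : int :=
  if (0 < n)%N && all (fun p => logn p n == 1%N) (primes n)
  then (-1) ^+ size (primes n) else 0.

(* A formal power series over R is its sequence of coefficients. *)
Section PowerSeries.
Variable R : comUnitRingType.
Implicit Types (a b : nat -> R) (p : {poly R}).

Definition fps_poly p : nat -> R := fun n => p`_n.

Definition fps_mul a b : nat -> R := fun n => \sum_(k < n.+1) a k * b (n - k)%N.

(* The coefficients 0, ..., n of the inverse of a, from b_0 = a_0^-1 and
   a_0 b_n.+1 = - (a_1 b_n + ... + a_n.+1 b_0). *)
Fixpoint fps_inv_seq a (n : nat) : seq R :=
  if n is n'.+1 then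
    let s := fps_inv_seq a n' in
    rcons s (- (a 0%N)^-1 * \sum_(k < n) a k.+1 * s`_(n' - k))
  else [:: (a 0%N)^-1].

Definition fps_inv a : nat -> R := fun n => (fps_inv_seq a n)`_n.

Lemma size_fps_inv_seq a n : size (fps_inv_seq a n) = n.+1.
Proof. by elim: n => //= n IHn; rewrite size_rcons IHn. Qed.

Lemma nth_fps_inv_seq a n k : (k <= n)%N -> (fps_inv_seq a n)`_k = fps_inv a k.
Proof.
elim: n => [|n IHn]; first by rewrite leqn0 => /eqP ->.
rewrite leq_eqVlt => /orP[/eqP -> //|]; rewrite ltnS => le_kn.
by rewrite /= nth_rcons size_fps_inv_seq ltnS le_kn IHn.
Qed.

Lemma fps_invS a n :
  fps_inv a n.+1 = - (a 0%N)^-1 * \sum_(k < n.+1) a k.+1 * fps_inv a (n - k)%N.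
Proof.
rewrite {1}/fps_inv /= nth_rcons size_fps_inv_seq ltnn eqxx; congr (_ * _).
by apply: eq_bigr => k _; rewrite nth_fps_inv_seq // leq_subr.
Qed.

Lemma fps_mulV a : a 0%N \is a GRing.unit ->
  fps_mul a (fps_inv a) =1 fps_poly 1.
Proof.
move=> a0U [|n]; rewrite /fps_mul /fps_poly coef1 big_ord_recl.
  by rewrite big_ord0 addr0 /fps_inv /= mulrV.
rewrite subn0 fps_invS mulNr mulrN mulrA mulrV // mul1r.
by apply/eqP; rewrite addrC subr_eq0; apply/eqP/eq_bigr.
Qed.

End PowerSeries.

Section NewtonPolynomials.

(* mesym M int i is the i-th elementary symmetric polynomial in M variables;
   the variable 'X_i of p (i < d) stands for x_(i+1). *)
Definition is_newton_poly (d : nat) (p : {mpoly int[d]}) : Prop :=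
  forall M : nat, (d <= M)%N ->
    p \mPo [tuple mesym M int i.+1 | i < d] = \sum_(j < M) 'X_j ^+ d.

Section NewtonIdentity.
Variable M : nat.
Local Notation E := (mesym M int).
Local Notation A := {mpoly int[M]}.

Let Ej (j : 'I_M) (k : nat) : A :=
  \sum_(h : {set 'I_M} | (#|h| == k) && (j \notin h)) \prod_(i in h) 'X_i.

Let EjS j k :
  \sum_(h : {set 'I_M} | (#|h| == k.+1) && (j \in h)) \prod_(i in h) 'X_i
  = 'X_j * Ej j k :> A.
Proof.
rewrite mulr_sumr (reindex_onto (fun h => j |: h) (fun h => h :\ j)) /=; last first.
  by move=> h /andP[_ jh]; rewrite setD1K.
apply: eq_big => [h|h].
  rewrite setU11 andbT; apply/andP/andP => [[ch /eqP hj]|[ch jh]].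
    have jh : j \notin h by rewrite -hj setD11.
    by move: ch; rewrite cardsU1 jh.
  by rewrite cardsU1 jh (eqP ch) setU1K.
move=> /andP[_ /eqP hj]; have jh : j \notin h by rewrite -hj setD11.
by rewrite big_setU1.
Qed.

Let EE j k : E k.+1 = 'X_j * Ej j k + Ej j k.+1.
Proof. by rewrite -EjS /mesym (bigID (fun h : {set 'I_M} => j \in h)). Qed.

Let Ej0 j : Ej j 0 = 1.
Proof.
rewrite /Ej (big_pred1 set0) ?big_set0 // => h.
by rewrite /= cards_eq0; case: eqP => [->|//]; rewrite in_set0.
Qed.

Let EjE j k :
  'X_j * Ej j k = \sum_(i < k.+1) (-1) ^+ i * 'X_j ^+ i.+1 * E (k - i)%N.
Proof.
elim: k => [|k IHk].
  by rewrite Ej0 big_ord1 expr0 expr1 mul1r subnn mesym0E.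
rewrite big_ord_recl expr0 expr1 mul1r subn0 (EE j k) mulrDr addrAC.
rewrite -[LHS]add0r; congr (_ + _); apply/esym/eqP; rewrite addr_eq0; apply/eqP.
rewrite IHk mulr_sumr -sumrN; apply: eq_bigr => i _.
rewrite lift0 subSS [(-1) ^+ _.+1]exprS ['X_j ^+ i.+2]exprS mulN1r !mulNr opprK.
by rewrite mulrA [X in X * _]mulrCA.
Qed.

Lemma newton_identity k :
  E k.+1 *+ k.+1 =
  \sum_(i < k.+1) (-1) ^+ i * (\sum_(j < M) 'X_j ^+ i.+1) * E (k - i)%N.
Proof.
transitivity (\sum_(j < M) 'X_j * Ej j k).
  under eq_bigr do rewrite -EjS.
  rewrite (exchange_big_dep (fun h : {set 'I_M} => #|h| == k.+1)) /=; last first.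
    by move=> j h _ /andP[].
  rewrite /mesym -sumrMnl; apply: eq_bigr => h /eqP ch.
  by rewrite -ch -sumr_const; apply: eq_bigl => j; rewrite eqxx.
under eq_bigr do rewrite EjE.
rewrite exchange_big /=; apply: eq_bigr => i _.
by rewrite -mulr_suml -mulr_sumr.
Qed.

End NewtonIdentity.

Let newton_rec (d k : nat) : {q : nat -> {mpoly int[d]} |
  forall i, (i < k)%N -> (i < d)%N -> forall M,
    q i \mPo [tuple mesym M int i.+1 | i < d] = \sum_(j < M) 'X_j ^+ i.+1}.
Proof.
pose x i : {mpoly int[d]} := if insub i is Some j then 'X_j else 0.
elim: k => [|k [q Hq]]; first by exists (fun=> 0).
pose r := (-1) ^+ k * (x k *+ k.+1
  - \sum_(i < k) (-1) ^+ i * q i * x (k - i.+1)%N).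
exists (fun i => if i == k then r else q i) => i; rewrite ltnS leq_eqVlt.
case: eqP => [-> _|_ /= lt_ik]; last exact: Hq.
move=> lt_kd M.
have xE i' : (i' < d)%N ->
    x i' \mPo [tuple mesym M int i.+1 | i < d] = mesym M int i'.+1.
  move=> lt_i'd; rewrite /x insubT comp_mpolyXU -tnth_nth tnth_mktuple //.
rewrite /r !rmorphM rmorphB rmorphMn rmorph_sum /= !rmorphXn /= rmorphN1 xE //.
rewrite newton_identity big_ord_recr /= subnn mesym0E mulr1.
under [X in _ - X]eq_bigr => j _.
  rewrite !rmorphM rmorphXn rmorphN1 /= Hq ?(ltn_trans (ltn_ord j) lt_kd) //.
  rewrite xE ?(leq_ltn_trans (leq_subr _ _)) // subnSK //.
  over.
by rewrite addrAC subrr add0r mulrA -exprD addnn -mul2n exprM sqrrN !expr1n mul1r.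
Qed.

(* For d = 0 the right-hand side is M, so no single polynomial works. *)
Lemma newton_poly_exists (d : nat) :
  {p : {mpoly int[d]} | (0 < d)%N -> is_newton_poly p}.
Proof.
case: d => [|d]; first by exists 0.
have [q Hq] := newton_rec d.+1 d.+1.
by exists (q d) => _ M _; apply: Hq.
Qed.

Lemma newton_poly_unique (d : nat) (p q : {mpoly int[d]}) :
  is_newton_poly p -> is_newton_poly q -> p = q.
Proof.
move=> Hp Hq; apply: msym_fundamental_un.
by rewrite (Hp d (leqnn d)) (Hq d (leqnn d)).
Qed.

Definition newton_poly (d : nat) : {mpoly int[d]} := sval (newton_poly_exists d).

Lemma newton_polyP (d : nat) : (0 < d)%N -> is_newton_poly (newton_poly d).
Proof. exact: (svalP (newton_poly_exists d)). Qed.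

(* p_d(x_1, x_2, ...); the value x 0 is not used. *)
Definition psum (d : nat) (x : nat -> int) : int :=
  (newton_poly d).@[fun i : 'I_d => x i.+1].

End NewtonPolynomials.

(* 1 + \sum_(0 <= i <= n) (-1)^(i+1) f_i t^(i+1) / (1 + t)^(i+1); its inverse is
   1 + s_1 t + s_2 t^2 + ... (see sseq0 for the constant coefficient). *)
Definition fseries (m : nat) (K : {set {set 'I_m}}) (n : nat) : nat -> int :=
  fun k => fps_poly 1 k +
    \sum_(i < n.+1) (-1) ^+ i.+1 * (fvec K i)%:Z *
      fps_mul (fps_poly 'X^(i.+1)) (fps_inv (fps_poly ((1 + 'X) ^+ i.+1))) k.

Definition sseq (m : nat) (K : {set {set 'I_m}}) (n : nat) : nat -> int :=
  fps_inv (fseries K n).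

Lemma fseries0 (m : nat) (K : {set {set 'I_m}}) (n : nat) : fseries K n 0 = 1.
Proof.
rewrite /fseries /fps_mul /fps_poly coef1 big1 ?addr0 // => i _.
by rewrite big_ord1 coefXn mul0r mulr0.
Qed.

Lemma sseq0 (m : nat) (K : {set {set 'I_m}}) (n : nat) : sseq K n 0 = 1.
Proof. by rewrite /sseq /fps_inv /= fseries0 invr1. Qed.

Definition alpha (m : nat) (K : {set {set 'I_m}}) (k : nat) : nat :=
  (\sum_(i < k) fvec K i * 'C(k.-1, i))%N.

(* Main.v *)
Require Import Defs.
From HB Require Import structures.
From mathcomp Require Import all_boot all_order all_algebra.
From mathcomp Require Import mpoly.
From mathcomp Require Import boolp ring zify.

Set Implicit Arguments.
Unset Strict Implicit.
Unset Printing Implicit Defensive.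

Import Order.TTheory GRing.Theory Num.Theory.
Local Open Scope ring_scope.

(** Write F(t) for the series inverted in the statement, so that F(-t) is
1 + alpha_1 t + alpha_2 t^2 + ... and S = 1 / F. Newton's identities say that
t a'(t) = a(t) (p_1 t - p_2 t^2 + p_3 t^3 - ...) for a series a with constant
term 1, hence p_d(s) = (-1)^(d-1) p_d(alpha) and both inequalities are the same.
The left-hand side is additive under products, and by Moebius inversion it equals
N l_N when S is the product of (1 + t^j)^(l_j) over odd j and of
(1 - t^j)^(- l_j) over even j; we need l_N >= 0.

For a set U of vertices let F_U be the sum of (- t / (1 + t))^|s| over the
simplices s contained in U. Flagness gives, for v in U with link L in U - v,
F_U = F_(U - v) - t / (1 + t) F_L. With H = F_L / F_(U - v) this reads
(1 + t) F_U = F_(U - v) (1 - t (H - 1)). By induction H has nonnegative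
coefficients, so 1 / F_U is 1 / F_(U - v) times 1 + t times 1 / (1 - B) with B
nonnegative, and 1 / (1 - B), the Hilbert series of a tensor algebra, is
decomposed into the required factors by Lazard elimination. *)

(** * Formal power series *)

Record fps (R : comUnitRingType) := Fps { fps_coef :> nat -> R }.

Section FpsRing.
Variable R : comUnitRingType.
Implicit Types a b c : fps R.

(** Equality of series is undecidable, so these structures come from classical axioms. *)
HB.instance Definition _ := gen_eqMixin (fps R).
HB.instance Definition _ := gen_choiceMixin (fps R).

Lemma fpsP a b : a =1 b -> a = b.
Proof. by case: a b => [a] [b] /= /funext ->. Qed.

Definition fps_add a b := Fps (fun n => a n + b n).
Definition fps_opp a := Fps (fun n => - a n).

Lemma fps_addA : associative fps_add.
Proof. by move=> a b c; apply: fpsP => n /=; rewrite addrA. Qed.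
Lemma fps_addC : commutative fps_add.
Proof. by move=> a b; apply: fpsP => n /=; rewrite addrC. Qed.
Lemma fps_add0 : left_id (Fps (fun=> 0)) fps_add.
Proof. by move=> a; apply: fpsP => n /=; rewrite add0r. Qed.
Lemma fps_addN : left_inverse (Fps (fun=> 0)) fps_opp fps_add.
Proof. by move=> a; apply: fpsP => n /=; rewrite addNr. Qed.

HB.instance Definition _ :=
  GRing.isZmodule.Build (fps R) fps_addA fps_addC fps_add0 fps_addN.

Definition fps_one := Fps (fun n => (n == 0%N)%:R : R).
Definition fps_mult a b := Fps (fps_mul a b).

Let trunc N (a : nat -> R) : {poly R} := \poly_(i < N.+1) a i.

(** Coefficient n of a product involves only coefficients up to n, so commutativity and
    associativity are inherited from truncations to polynomials. *)
Let fps_mul_trunc N (a b : nat -> R) n : (n <= N)%N ->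
  fps_mul a b n = (trunc N a * trunc N b)`_n.
Proof.
move=> nN; rewrite coefM; apply: eq_bigr => k _; rewrite !coef_poly !ltnS.
by rewrite (leq_trans (leq_subr _ _) nN) (leq_trans _ nN) // -ltnS.
Qed.

Lemma fps_mulC : commutative fps_mult.
Proof. by move=> a b; apply: fpsP => n /=; rewrite !(@fps_mul_trunc n) // mulrC. Qed.

Lemma fps_mulA : associative fps_mult.
Proof.
move=> a b c; apply: fpsP => n /=.
transitivity ((trunc n a * (trunc n b * trunc n c))`_n).
  rewrite coefM; apply: eq_bigr => k _.
  by rewrite coef_poly ltn_ord (@fps_mul_trunc n) // leq_subr.
rewrite mulrA coefM; apply: eq_bigr => k _.
by rewrite [in RHS](@fps_mul_trunc n) -1?ltnS // coef_poly ltnS leq_subr.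
Qed.

Lemma fps_mul1 : left_id fps_one fps_mult.
Proof.
move=> a; apply: fpsP => n /=; rewrite /fps_mul big_ord_recl /= mul1r subn0.
by rewrite big1 ?addr0 // => i _; rewrite mul0r.
Qed.

Lemma fps_mulDl : left_distributive fps_mult fps_add.
Proof.
move=> a b c; apply: fpsP => n /=; rewrite /fps_mul -big_split /=.
by apply: eq_bigr => i _; rewrite mulrDl.
Qed.

Lemma fps_one_neq0 : fps_one != 0.
Proof.
by apply/eqP => /(congr1 (fun a : fps R => a 0%N)) /= /eqP; rewrite oner_eq0.
Qed.

HB.instance Definition _ := GRing.Zmodule_isComNzRing.Build (fps R)
  fps_mulA fps_mulC fps_mul1 fps_mulDl fps_one_neq0.

Lemma coef_fpsD a b n : (a + b) n = a n + b n. Proof. by []. Qed.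
Lemma coef_fpsN a n : (- a) n = - a n. Proof. by []. Qed.
Lemma coef_fps1 n : (1 : fps R) n = (n == 0%N)%:R. Proof. by []. Qed.
Lemma coef_fpsM a b n : (a * b) n = \sum_(k < n.+1) a k * b (n - k)%N.
Proof. by []. Qed.

Lemma coef_fpsM0 a b : (a * b) 0%N = a 0%N * b 0%N.
Proof. by rewrite coef_fpsM big_ord1. Qed.

Lemma coef_fps_sum I (r : seq I) (P : pred I) (F : I -> fps R) n :
  (\sum_(i <- r | P i) F i) n = \sum_(i <- r | P i) F i n.
Proof. by elim/big_rec2: _ => // i x y _ <-. Qed.

Lemma coef_fpsMn a j n : (a *+ j) n = a n *+ j.
Proof. by elim: j => // j IHj; rewrite !mulrS coef_fpsD IHj. Qed.

Lemma fps_inverse a : a 0%N = 1 -> a * Fps (fps_inv a) = 1.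
Proof.
move=> a0; apply: fpsP => n.
rewrite coef_fps1 -coef1; apply: fps_mulV.
by rewrite a0 unitr1.
Qed.

Lemma fps_mulIr a b c : c 0%N = 1 -> a * c = b * c -> a = b.
Proof.
move=> /fps_inverse c1 /(congr1 (fun x => x * Fps (fps_inv c))).
by rewrite -!mulrA c1 !mulr1.
Qed.

Definition fps_mono k : fps R := Fps (fun n => (n == k)%:R).

Lemma coef_fps_monoM k a n :
  (fps_mono k * a) n = if (k <= n)%N then a (n - k)%N else 0.
Proof.
rewrite coef_fpsM; case: leqP => kn.
  have lt_kn : (k < n.+1)%N by [].
  rewrite (bigD1 (Ordinal lt_kn)) //= eqxx mul1r big1 ?addr0 // => i ik.
  suff /negPf -> : val i != k by rewrite mul0r.
  by apply: contraNneq ik => ik; apply/eqP/val_inj.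
apply: big1 => i _ /=; rewrite ltn_eqF ?mul0r //.
by rewrite (leq_ltn_trans _ kn) // -ltnS.
Qed.

Lemma fps_monoD j k : fps_mono (j + k) = fps_mono j * fps_mono k.
Proof.
apply: fpsP => n; rewrite coef_fps_monoM /=.
case: leqP => jn; last by rewrite ltn_eqF // ltn_addr.
by rewrite -(eqn_add2l j (n - j)) subnKC.
Qed.

(* The derivation t d/dt, which unlike d/dt preserves degrees. *)
Definition fps_theta a : fps R := Fps (fun n => a n *+ n).

Lemma fps_thetaM a b : fps_theta (a * b) = fps_theta a * b + a * fps_theta b.
Proof.
apply: fpsP => n; rewrite coef_fpsD !coef_fpsM /= /fps_mul -sumrMnl -big_split /=.
apply: eq_bigr => i _; rewrite mulrnAl mulrnAr -mulrnDr.
by rewrite subnKC // -ltnS.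
Qed.

(** The substitution of - t for t. *)
Definition fps_twist a : fps R := Fps (fun n => (-1) ^+ n * a n).

Lemma coef_fps_twist a n : fps_twist a n = (-1) ^+ n * a n. Proof. by []. Qed.

Lemma fps_twistM a b : fps_twist (a * b) = fps_twist a * fps_twist b.
Proof.
apply: fpsP => n; rewrite coef_fpsM /= /fps_mul mulr_sumr.
apply: eq_bigr => i _.
have -> : (-1) ^+ n = (-1) ^+ i * (-1) ^+ (n - i) :> R.
  by rewrite -exprD subnKC // -ltnS.
by rewrite mulrACA.
Qed.

Lemma fps_twist1 : fps_twist 1 = 1.
Proof. by apply: fpsP => -[|n]; rewrite /= ?mul1r ?mulr0. Qed.

Lemma fps_theta_twist a : fps_theta (fps_twist a) = fps_twist (fps_theta a).
Proof. by apply: fpsP => n /=; rewrite mulrnAr. Qed.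

End FpsRing.

Arguments fps_mono {R}.

(** * Newton power sums as a logarithmic derivative *)

(** Elementary symmetric polynomials in k + 1 variables are algebraically independent, so Newton's
    identity lifts to one between free variables, which then specialise to the integers [x]. *)
Lemma newton_identity_psum (x : nat -> int) k : x 0%N = 1 ->
  x k.+1 *+ k.+1 = \sum_(i < k.+1) (-1) ^+ i * psum i.+1 x * x (k - i)%N.
Proof.
move=> x0; set M := k.+1.
pose E := [tuple mesym M int i.+1 | i < M].
(* The generic sequence, with [y 0 = 1]; the default 0 beyond index M is never reached. *)
pose y j : {mpoly int[M]} :=
  if j is j'.+1 then if insub j' is Some o then 'X_o else 0 else 1.
pose nu d := newton_poly d \mPo [tuple y i.+1 | i < d].
have yE j : (j <= M)%N -> y j \mPo E = mesym M int j.
  case: j => [|j] jM; first by rewrite comp_mpoly1 mesym0E.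
  by rewrite /y insubT comp_mpolyXU -tnth_nth tnth_mktuple.
have yv j : (j <= M)%N -> (y j).@[fun i : 'I_M => x i.+1] = x j.
  case: j => [|j] jM; first by rewrite /y meval1.
  by rewrite /y insubT mevalXU.
have nuv d : (d <= M)%N -> (nu d).@[fun i : 'I_M => x i.+1] = psum d x.
  move=> dM; rewrite /nu comp_mpoly_meval; apply: meval_eq => i.
  by rewrite tnth_mktuple yv // (leq_trans (ltn_ord i)).
have nuE d : (0 < d <= M)%N -> nu d \mPo E = \sum_(j < M) 'X_j ^+ d.
  case/andP=> d0 dM; rewrite -(newton_polyP d0 dM) /nu.
  rewrite !(comp_mpolyE (newton_poly d)) raddf_sum /=; apply: eq_bigr => u _.
  rewrite comp_mpolyZ rmorph_prod /=; congr (_ *: _); apply: eq_bigr => i _.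
  by rewrite !tnth_mktuple -yE ?(leq_trans (ltn_ord i)) // rmorphXn.
have key : y k.+1 *+ k.+1 = \sum_(i < k.+1) (-1) ^+ i * nu i.+1 * y (k - i)%N.
  apply: msym_fundamental_un; rewrite -/E comp_mpolyMn yE // newton_identity.
  rewrite raddf_sum; apply: eq_bigr => i _ /=.
  rewrite !rmorphM rmorphXn rmorphN1 /= nuE ?ltn_ord //= yE //.
  by rewrite (leq_trans (leq_subr _ _)).
have /(congr1 (meval (fun i : 'I_M => x i.+1))) := key.
rewrite mevalMn yv // raddf_sum => ->; apply: eq_bigr => i _.
rewrite /= !mevalM rmorphXn rmorphN1 /= nuv ?ltn_ord //= yv //.
by rewrite (leq_trans (leq_subr _ _)).
Qed.

(** The logarithmic derivative t a' / a when a has constant term 1. Degree 0 is set to 0, as no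
    Newton polynomial exists there. *)
Definition psum_series (a : fps int) : fps int :=
  Fps (fun d => if d is 0 then 0 else (-1) ^+ d.+1 * psum d a).

Lemma fps_theta_psum (a : fps int) : a 0%N = 1 ->
  fps_theta a = a * psum_series a.
Proof.
move=> a0; rewrite mulrC; apply: fpsP => -[|k]; first by rewrite coef_fpsM0 mul0r.
rewrite coef_fpsM big_ord_recl /= mul0r add0r newton_identity_psum //.
by apply: eq_bigr => i _ /=; rewrite !exprS !mulN1r opprK.
Qed.

(** The tool for computing power sums: guess [q] and check one product, without unfolding Newton
    polynomials. *)
Lemma psum_series_unique (a q : fps int) : a 0%N = 1 ->
  fps_theta a = a * q -> psum_series a = q.
Proof.
by move=> a0; rewrite fps_theta_psum // ![a * _]mulrC; apply: fps_mulIr.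
Qed.

Lemma psum_seriesM (a b : fps int) : a 0%N = 1 -> b 0%N = 1 ->
  psum_series (a * b) = psum_series a + psum_series b.
Proof.
move=> a0 b0; apply: psum_series_unique; first by rewrite coef_fpsM0 a0 b0.
by rewrite fps_thetaM !fps_theta_psum //; ring.
Qed.

Lemma psum_series_twist (a : fps int) : a 0%N = 1 ->
  psum_series (fps_twist a) = fps_twist (psum_series a).
Proof.
move=> a0; apply: psum_series_unique; first by rewrite /= a0 mul1r.
by rewrite fps_theta_twist fps_theta_psum // fps_twistM.
Qed.

Lemma psum_series1 : psum_series 1 = 0.
Proof.
apply: psum_series_unique => //; rewrite mulr0; apply: fpsP => -[|n] //=.
by rewrite mul0rn.
Qed.

(** * Moebius inversion *)

Lemma filter_dvd_divisors k n : (0 < n)%N -> (k %| n)%N ->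
  perm_eq [seq d <- divisors n | (k %| d)%N]
          [seq (k * e)%N | e <- divisors (n %/ k)].
Proof.
move=> n0 kn; have k0 := dvdn_gt0 n0 kn.
have q0 : (0 < n %/ k)%N by rewrite divn_gt0 // dvdn_leq.
apply: uniq_perm; first by rewrite filter_uniq // divisors_uniq.
  rewrite map_inj_uniq ?divisors_uniq // => i j /eqP.
  by rewrite eqn_pmul2l // => /eqP.
move=> d; rewrite mem_filter -dvdn_divisors //; apply/andP/mapP => [[kd dn]|].
  exists (d %/ k)%N; last by rewrite mulnC divnK.
  by rewrite -dvdn_divisors // -(dvdn_pmul2r k0) !divnK.
move=> [e]; rewrite -dvdn_divisors // => en ->; rewrite dvdn_mulr //.
by rewrite -(divnK kn) mulnC dvdn_pmul2r.
Qed.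

(** If p divides e then p occurs at least twice in p e; otherwise p e has exactly one more prime
    factor than e, with the other exponents unchanged. *)
Lemma mobius_mul_prime p e : prime p -> (0 < e)%N ->
  mobius (p * e) = if (p %| e)%N then 0 else - mobius e.
Proof.
move=> pp e0; have p0 := prime_gt0 pp; rewrite /mobius muln_gt0 p0 e0 /=.
have pm : p \in primes (p * e) by rewrite primesM // primes_prime // mem_seq1 eqxx.
case: (boolP (p %| e)%N) => pe.
  have : (0 < logn p e)%N by rewrite logn_gt0 mem_primes pp e0.
  case: ifP => // /allP H; have /eqP := H p pm.
  by rewrite lognM // logn_prime // eqxx; case: logn.
have lpe : logn p e = 0%N by apply/eqP; rewrite -leqn0 leqNgt logn_gt0 mem_primes pp e0.
have pr : perm_eq (primes (p * e)) (p :: primes e).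
  apply: uniq_perm; rewrite /= ?primes_uniq ?andbT ?mem_primes ?(negPf pe) ?andbF //.
  by move=> q; rewrite primesM // primes_prime // !inE.
rewrite (perm_all _ pr) (perm_size pr) /= lognM // logn_prime // eqxx lpe /=.
have -> : all (fun q => logn q (p * e) == 1%N) (primes e) =
          all (fun q => logn q e == 1%N) (primes e).
  apply: eq_in_all => q qe; rewrite lognM // logn_prime //.
  suff /negPf -> : q != p by [].
  by apply: contraTneq qe => ->; rewrite mem_primes (negPf pe) !andbF.
by case: all; rewrite ?oppr0 // exprS mulN1r.
Qed.

(* With p a prime factor of n, the divisors d and p d with p not dividing d
   cancel, and the others contribute 0. *)
Lemma sum_mobius n : (0 < n)%N ->
  \sum_(d <- divisors n) mobius d = (n == 1%N)%:R.
Proof.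
case: n => [|[|n]] // _; first by rewrite big_seq1.
set N := n.+2; have pp : prime (pdiv N) by rewrite pdiv_prime.
have pN : (pdiv N %| N)%N := pdiv_dvd N; set p := pdiv N in pp pN *.
have p0 := prime_gt0 pp.
have q0 : (0 < N %/ p)%N by rewrite divn_gt0 // dvdn_leq.
rewrite (bigID (fun d => p %| d)%N) /= -big_filter.
rewrite (perm_big _ (filter_dvd_divisors _ pN)) //= big_map.
rewrite big_seq (eq_bigr (fun e => if (p %| e)%N then 0 else - mobius e)); last first.
  move=> e; rewrite -dvdn_divisors // => eN.
  by rewrite mobius_mul_prime // (dvdn_gt0 q0 eN).
rewrite -big_seq -[X in _ + X]big_filter.
(* By Gauss, a divisor of N prime to p already divides N / p. *)
have -> : \sum_(d <- [seq d <- divisors N | ~~ (p %| d)%N]) mobius d =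
          \sum_(d <- [seq d <- divisors (N %/ p) | ~~ (p %| d)%N]) mobius d.
  apply: perm_big; apply: uniq_perm; rewrite ?filter_uniq ?divisors_uniq //.
  move=> d; rewrite !mem_filter -!dvdn_divisors //.
  case: (boolP (p %| d)%N) => //= pd.
  rewrite -[X in (d %| X)%N](divnK pN) Gauss_dvdl // coprime_sym.
  by rewrite prime_coprime.
rewrite big_filter (bigID (fun e => p %| e)%N) /= [X in X + _ + _]big1 ?add0r; last first.
  by move=> e ->.
rewrite (eq_bigr (fun e => - mobius e)) => [|e /negPf -> //].
by rewrite sumrN addNr.
Qed.

Lemma sum_mobius_div n : (0 < n)%N ->
  \sum_(d <- divisors n) mobius (n %/ d) = (n == 1%N)%:R.
Proof.
move=> n0; rewrite -sum_mobius //.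
rewrite -(big_map (fun d => n %/ d)%N predT mobius).
apply: perm_big; apply: uniq_perm; rewrite ?divisors_uniq //.
  rewrite map_inj_in_uniq ?divisors_uniq // => i j.
  rewrite -!dvdn_divisors // => iN jN eij.
  have q0 : (0 < n %/ i)%N by rewrite divn_gt0 ?(dvdn_gt0 n0 iN) // dvdn_leq.
  by apply/eqP; rewrite -(eqn_pmul2l q0) divnK // eij divnK.
move=> d; rewrite -dvdn_divisors //; apply/mapP/idP => [[e]|dn].
  by rewrite -dvdn_divisors // => en ->; rewrite dvdn_div.
by exists (n %/ d)%N; rewrite -?dvdn_divisors ?dvdn_div // divnA // mulKn.
Qed.

(** Only the d = k e with e dividing N / k contribute, which leaves the full Moebius sum of N / k.
    This is the form of inversion that isolates the factor of degree N. *)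
Lemma sum_mobius_dvd N k : (0 < N)%N ->
  \sum_(d <- divisors N) mobius (N %/ d) * (k %| d)%N%:R = (N == k)%:R.
Proof.
move=> N0; case: (boolP (k %| N)%N) => kN; last first.
  have -> : (N == k) = false by apply: contraNF kN => /eqP ->.
  rewrite big_seq big1 // => d; rewrite -dvdn_divisors // => dN.
  have /negPf -> : ~~ (k %| d)%N by apply: contraNN kN => /dvdn_trans; apply.
  by rewrite mulr0.
have k0 := dvdn_gt0 N0 kN.
have q0 : (0 < N %/ k)%N by rewrite divn_gt0 // dvdn_leq.
rewrite (bigID (fun d => k %| d)%N) /= [X in _ + X]big1 ?addr0; last first.
  by move=> d /negPf ->; rewrite mulr0.
rewrite (eq_bigr (fun d => mobius (N %/ d))) => [|d ->]; last by rewrite mulr1.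
rewrite -big_filter (perm_big _ (filter_dvd_divisors N0 kN)) /= big_map.
under eq_bigr do rewrite divnMA.
rewrite sum_mobius_div //; congr (nat_of_bool _)%:R.
by rewrite -(eqn_pmul2r k0) divnK // mul1n.
Qed.

(** * Nonnegativity of the exponents l_N *)

Lemma psum_eq d (x y : nat -> int) :
  (forall i, (0 < i <= d)%N -> x i = y i) -> psum d x = psum d y.
Proof. by move=> xy; apply: meval_eq => i; apply: xy; rewrite /= ltn_ord. Qed.

(* If a is the product of (1 + t^j)^(l_j) for odd j and (1 - t^j)^(- l_j) for
   even j, then pbw_rank N a = N l_N: by the Poincare-Birkhoff-Witt theorem,
   l_N is the dimension of the degree N part of a graded Lie superalgebra whose
   enveloping algebra has Hilbert series a. *)
Definition pbw_rank (N : nat) (a : fps int) : int :=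
  (-1) ^+ N * \sum_(d <- divisors N) mobius (N %/ d) * (-1) ^+ d * psum_series a d.

Section PbwRank.
Variable N : nat.
Hypothesis N0 : (0 < N)%N.
Implicit Types a b : fps int.

Lemma pbw_rankE a :
  pbw_rank N a = (-1) ^+ N.+1 * \sum_(d <- divisors N) mobius (N %/ d) * psum d a.
Proof.
rewrite /pbw_rank exprS mulN1r mulNr -mulrN -sumrN; congr (_ * _).
rewrite big_seq [RHS]big_seq; apply: eq_bigr => d.
rewrite -dvdn_divisors // => /(dvdn_gt0 N0); case: d => // d _ /=.
by rewrite mulrA -(mulrA (mobius _)) -exprD addnS exprS addnn -mul2n exprM sqrrN
   !expr1n mulr1 mulrN1 mulNr.
Qed.

Lemma pbw_rankM a b : a 0%N = 1 -> b 0%N = 1 ->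
  pbw_rank N (a * b) = pbw_rank N a + pbw_rank N b.
Proof.
move=> a0 b0; rewrite /pbw_rank psum_seriesM // -mulrDr -big_split /=.
by congr (_ * _); apply: eq_bigr => d _; rewrite -mulrDr.
Qed.

Lemma pbw_rank1 : pbw_rank N 1 = 0.
Proof. by rewrite /pbw_rank psum_series1 big1 ?mulr0 // => d _; rewrite mulr0. Qed.

Lemma eq_pbw_rank a b : (forall i, (i <= N)%N -> a i = b i) ->
  pbw_rank N a = pbw_rank N b.
Proof.
move=> ab; rewrite !pbw_rankE; congr (_ * _); rewrite !big_seq.
apply: eq_bigr => d; rewrite -dvdn_divisors // => dN; congr (_ * _).
apply: psum_eq => i /andP[_ id]; apply: ab.
exact: leq_trans id (dvdn_leq N0 dN).
Qed.

(** The logarithmic derivative of 1 - t^k is - k t^k / (1 - t^k). *)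
Lemma psum_series_1Bmono k d : (0 < k)%N -> (0 < d)%N ->
  psum_series (1 - fps_mono k) d = - (k%:R * (k %| d)%N%:R).
Proof.
move=> k0 d0.
pose q : fps int := Fps (fun n => if n == 0%N then 0 else - (k%:R * (k %| n)%N%:R)).
suff -> : psum_series (1 - fps_mono k) = q by rewrite /q /= gtn_eqF.
apply: psum_series_unique; first by rewrite coef_fpsD coef_fpsN /= eq_sym gtn_eqF // subr0.
apply: fpsP => n; rewrite mulrBl mul1r coef_fpsD coef_fpsN coef_fps_monoM.
rewrite /=.
have [->|n0] := eqVneq n 0%N; first by rewrite leqNgt k0 subr0.
rewrite sub0r mulNrn; case: leqP => nk; last first.
  by rewrite ltn_eqF // (negPf (_ : ~~ (k %| n)%N)) ?mulr0 ?subr0 ?mul0rn // gtnNdvd // lt0n.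
have [->|nk'] := eqVneq n k; first by rewrite subnn dvdnn mulr1 subr0.
rewrite subn_eq0 leqNgt ltn_neqAle eq_sym nk' nk /=.
by rewrite dvdn_subl ?dvdnn // subrr mul0rn oppr0.
Qed.

Lemma twist_1Bmono k : odd k -> fps_twist (1 - fps_mono k) = 1 + fps_mono k :> fps int.
Proof.
move=> ok; apply: fpsP => n /=.
have [->|n0] := eqVneq n 0%N; first by case: k ok => // k _; rewrite expr0 mul1r subr0 addr0.
have [->|] := eqVneq n k; last by rewrite subr0 mulr0.
by rewrite -signr_odd ok expr1 sub0r mulN1r opprK add0r.
Qed.

Lemma sum_mobius_mul k :
  \sum_(d <- divisors N) mobius (N %/ d) * (k%:R * (k %| d)%N%:R) = (k * (N == k))%:R.
Proof.
rewrite natrM -(sum_mobius_dvd k N0) mulr_sumr.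
by apply: eq_bigr => d _; rewrite mulrCA.
Qed.

(** For odd k, 1 + t^k is the twist of 1 - t^k. The twist absorbs the signs (-1)^d, and Moebius
    inversion leaves k if N = k and 0 otherwise. *)
Lemma pbw_rank_1Dmono k : odd k -> 0 <= pbw_rank N (1 + fps_mono k).
Proof.
move=> ok; have k0 : (0 < k)%N by case: k ok.
suff -> : pbw_rank N (1 + fps_mono k) = (k * (N == k))%:R by rewrite ler0n.
rewrite -twist_1Bmono // /pbw_rank psum_series_twist; last first.
  by rewrite coef_fpsD coef_fpsN /= eq_sym gtn_eqF // subr0.
have -> : \sum_(d <- divisors N) mobius (N %/ d) * (-1) ^+ d *
    fps_twist (psum_series (1 - fps_mono k)) d = - (k * (N == k))%:R.
  rewrite -sum_mobius_mul -sumrN big_seq [RHS]big_seq; apply: eq_bigr => d.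
  rewrite -dvdn_divisors // => /(dvdn_gt0 N0) d0.
  rewrite coef_fps_twist psum_series_1Bmono //.
  by rewrite -mulrA signrMK mulrN.
case: (eqVneq N k) => [->|_]; last by rewrite muln0 oppr0 mulr0.
by rewrite -signr_odd ok expr1 mulN1r opprK.
Qed.

(** For even k only even d contribute, so the signs (-1)^d disappear. *)
Lemma pbw_rank_1Bmono k : (0 < k)%N -> ~~ odd k ->
  pbw_rank N (1 - fps_mono k) <= 0.
Proof.
move=> k0 ek.
suff -> : pbw_rank N (1 - fps_mono k) = - (k * (N == k))%:R by rewrite oppr_le0 ler0n.
rewrite /pbw_rank.
have -> : \sum_(d <- divisors N) mobius (N %/ d) * (-1) ^+ d *
    psum_series (1 - fps_mono k) d = - (k * (N == k))%:R.
  rewrite -sum_mobius_mul -sumrN big_seq [RHS]big_seq; apply: eq_bigr => d.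
  rewrite -dvdn_divisors // => /(dvdn_gt0 N0) d0; rewrite psum_series_1Bmono //.
  have [kd|_] := boolP (k %| d)%N; last by rewrite mulr0 oppr0 !mulr0 oppr0.
  rewrite -(signr_odd _ d) (_ : odd d = false) ?expr0 ?mulr1 ?mulrN //.
  by apply: contraNF ek; apply: dvdn_odd.
case: (eqVneq N k) => [->|_]; last by rewrite muln0 oppr0 mulr0.
by rewrite -signr_odd (negPf ek) expr0 mul1r.
Qed.

End PbwRank.

(** * Series with nonnegative coefficients and Lazard elimination *)

Definition fps_nonneg (a : fps int) : Prop := forall n, 0 <= a n.

Lemma fps_nonnegD a b : fps_nonneg a -> fps_nonneg b -> fps_nonneg (a + b).
Proof. by move=> a0 b0 n; rewrite coef_fpsD addr_ge0. Qed.

Lemma fps_nonnegM a b : fps_nonneg a -> fps_nonneg b -> fps_nonneg (a * b).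
Proof. by move=> a0 b0 n; rewrite coef_fpsM sumr_ge0 // => i _; rewrite mulr_ge0. Qed.

Lemma fps_nonneg_mono k : fps_nonneg (fps_mono k).
Proof. by move=> n; rewrite /= ler0n. Qed.

Lemma fps_nonneg1 : fps_nonneg 1.
Proof. by move=> n; rewrite coef_fps1 ler0n. Qed.

(** Since V = 1 + B V and B has no constant term, each coefficient of V is a nonnegative combination
    of earlier ones, plus 1 in degree 0. *)
Lemma fps_nonneg_inv1B (B V : fps int) : fps_nonneg B -> B 0%N = 0 ->
  V * (1 - B) = 1 -> fps_nonneg V.
Proof.
move=> Bge B0 VB; have {}VB : V = 1 + B * V by rewrite -VB; ring.
move=> n; elim/ltn_ind: n => n IH; rewrite VB coef_fpsD addr_ge0 ?fps_nonneg1 //.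
rewrite coef_fpsM big_ord_recl /= B0 mul0r add0r sumr_ge0 // => i _.
by rewrite mulr_ge0 // IH // /bump /= ltn_subrL (leq_ltn_trans _ (ltn_ord i)).
Qed.

(* Lazard elimination in a free Lie superalgebra: remove one generator x of the
   lowest degree k. For k odd, [x, x] survives as a new generator of degree 2k. *)
Lemma pbw_rank_free N (B : fps int) : (0 < N)%N -> fps_nonneg B -> B 0%N = 0 ->
  pbw_rank N (1 - B) <= 0.
Proof.
move=> N0 Bge B0.
have : forall i, (i + N <= N)%N -> B i = 0 by move=> i; case: i => // i; lia.
(* Outer induction: B vanishes through degree N - j. At j = 0, the series 1 - B agrees with 1 in all
   degrees that matter. *)
move: {1}N => j; elim: j => [|j IHj] in B Bge B0 *.
  move=> Bz; rewrite -[leRHS](@pbw_rank1 N) le_eqVlt; apply/orP; left; apply/eqP.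
  apply: eq_pbw_rank => // i iN.
  by rewrite coef_fpsD coef_fpsN Bz ?addn0 // subr0.
move=> Bz; have [Nj|jN] := leqP N j.
  by apply: IHj => // -[|i] // iN; lia.
pose k := (N - j)%N; have k0 : (0 < k)%N by rewrite subn_gt0.
have {}Bz i : (i < k)%N -> B i = 0 by move=> ik; apply: Bz; lia.
have [b Bk] : exists b : nat, B k = b%:R.
  by exists `|B k|%N; rewrite natz gez0_abs.
(* Inner induction on the number b of generators of the lowest degree k; when none is left, B
   vanishes through degree k. *)
elim: b => [|b IHb] in B Bge B0 Bz Bk *.
  apply: IHj => // i ij; have : (i <= k)%N by lia.
  by rewrite leq_eqVlt => /orP[/eqP ->//|/Bz].
pose C := B - fps_mono k.
have Ck : C k = b%:R.
  by rewrite coef_fpsD coef_fpsN /= eqxx Bk -natr1 addrK.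
have Cn i : i != k -> C i = B i.
  by move=> /negPf ik; rewrite coef_fpsD coef_fpsN /= ik subr0.
have C0 : C 0%N = 0 by rewrite Cn // neq_ltn k0.
have Cz i : (i < k)%N -> C i = 0 by move=> ik; rewrite Cn ?Bz // ltn_eqF.
have Cge : fps_nonneg C.
  by move=> i; have [->|ik] := eqVneq i k; rewrite ?Ck ?ler0n // Cn.
have BC : B = fps_mono k + C by rewrite /C addrC subrK.
have ek0 : (0 == k)%N = false by rewrite ltn_eqF.
have [ok|ek] := boolP (odd k).
  (* The surviving generators are [x, x], and c and [x, c] for each other generator c. *)
  pose D := fps_mono (k + k) + C * (1 + fps_mono k).
  have Di i : (i <= k)%N -> D i = C i.
    move=> ik; rewrite /D mulrDr mulr1 [C * _]mulrC !coef_fpsD coef_fps_monoM /=.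
    rewrite ltn_eqF ?add0r; last by lia.
    case: leqP => ki; last by rewrite addr0.
    by rewrite (_ : (i - k)%N = 0%N) ?C0 ?addr0 //; lia.
  have : pbw_rank N (1 - D) <= 0.
    apply: IHb; rewrite ?Di //; last by move=> i ik; rewrite Di ?Cz // ltnW.
    apply: fps_nonnegD; first exact: fps_nonneg_mono.
    apply: fps_nonnegM => //; apply: fps_nonnegD; first exact: fps_nonneg1.
    exact: fps_nonneg_mono.
  have -> : 1 - D = (1 - B) * (1 + fps_mono k) by rewrite /D fps_monoD BC; ring.
  rewrite pbw_rankM; last 2 first.
  - by rewrite coef_fpsD coef_fpsN B0 subr0.
  - by rewrite coef_fpsD /= ek0 addr0.
  by move=> le0; rewrite (le_trans _ le0) // lerDl pbw_rank_1Dmono.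
(* G is 1 / (1 - t^k); for even k the surviving generators are all ad(x)^i c, counted by C G. *)
pose G : fps int := Fps (fun n => (k %| n)%N%:R).
have G1 : G = 1 + fps_mono k * G.
  apply: fpsP => n; rewrite coef_fpsD coef_fps_monoM coef_fps1 /=.
  have [->|n0] := eqVneq n 0%N; first by rewrite dvdn0 leqNgt k0 addr0.
  rewrite add0r; case: leqP => nk; first by rewrite dvdn_subl ?dvdnn.
  by rewrite gtnNdvd // lt0n.
pose D := C * G.
have Di i : (i <= k)%N -> D i = C i.
  move=> ik; have -> : D = C + fps_mono k * D by rewrite /D {1}G1; ring.
  rewrite coef_fpsD coef_fps_monoM; case: leqP => ki; last by rewrite addr0.
  by rewrite (_ : (i - k)%N = 0%N) ?coef_fpsM0 ?C0 ?mul0r ?addr0 //; lia.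
have : pbw_rank N (1 - D) <= 0.
  apply: IHb; rewrite ?Di //; last by move=> i ik; rewrite Di ?Cz // ltnW.
  by apply: fps_nonnegM => // n; rewrite /= ler0n.
have -> : 1 - B = (1 - fps_mono k) * (1 - D).
  have E : C = D - fps_mono k * D by rewrite /D {1}G1; ring.
  by rewrite BC {1}E; ring.
rewrite pbw_rankM; last 2 first.
- by rewrite coef_fpsD coef_fpsN /= ek0 subr0.
- by rewrite coef_fpsD coef_fpsN Di // C0 subr0.
by move=> le0; rewrite -[leRHS]addr0 lerD // pbw_rank_1Bmono.
Qed.

(** * The face series of a flag complex *)

(* The series t / (1 + t). *)
Definition fps_tdiv : fps int := Fps (fun n => if n is n'.+1 then (-1) ^+ n' else 0).

Lemma fps_tdivM : fps_tdiv * (1 + fps_mono 1) = fps_mono 1.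
Proof.
rewrite mulrDr mulr1 [fps_tdiv * _]mulrC; apply: fpsP => n.
rewrite coef_fpsD coef_fps_monoM; case: n => [|[|n]] //=.
by rewrite exprS mulN1r addNr.
Qed.

Section FaceSeries.
Variables (m : nat) (K : {set {set 'I_m}}).
Hypotheses (hK : simplicial_complex K) (hflag : flag K) (K0 : set0 \in K).
Implicit Types (U h s : {set 'I_m}) (v : 'I_m).

Definition face_series U : fps int :=
  \sum_(s in K | s \subset U) (- fps_tdiv) ^+ #|s|.

Definition link_vertices v U := [set w in U | [set v; w] \in K].

Lemma link_vertices_sub v U : link_vertices v U \subset U.
Proof. by apply/subsetP => w; rewrite inE => /andP[]. Qed.

(** Otherwise [v |: h] contains a minimal non-face, which has two elements by flagness. It contains
    v because h is a face, so it is {v, w} with w in h, yet such pairs are faces. *)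
Lemma flag_cone v U h : h \in K -> h \subset link_vertices v U -> v |: h \in K.
Proof.
move=> hin /subsetP hlk; apply/negPn/negP => vh.
have [A /minsetP[AK Amin] Avh] :=
  @minset_exists _ (fun A : {set 'I_m} => A \notin K) _ vh.
have /hflag A2 : minimal_nonface K A.
  split=> // t tA; apply/negPn/negP => /Amin/(_ (proper_sub tA)) tE.
  by rewrite tE properxx in tA.
have [vA|vA] := boolP (v \in A); last first.
  case/negP: AK; apply: hK.1 hin _; apply/subsetP => x xA.
  have := subsetP Avh x xA; rewrite !inE => /orP[/eqP xv|//].
  by rewrite -xv xA in vA.
have /cards1P[w Aw] : #|A :\ v| == 1%N.
  by move: A2; rewrite (cardsD1 v) vA add1n => -[->].
have wA : w \in A :\ v by rewrite Aw set11.
move: wA; rewrite in_setD1 => /andP[wv wA].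
have : w \in link_vertices v U.
  by apply: hlk; have := subsetP Avh w wA; rewrite !inE (negPf wv).
by rewrite inE -Aw setD1K // (negPf AK) andbF.
Qed.

(** The faces containing v are exactly the cones [v |: h] over faces h on the link vertices, each
    with one more factor - t / (1 + t). *)
Lemma face_series_rec U v : v \in U ->
  face_series U =
  face_series (U :\ v) - fps_tdiv * face_series (link_vertices v (U :\ v)).
Proof.
move=> vU; rewrite /face_series (bigID (fun s => v \in s)) /= addrC; congr (_ + _).
  by apply: eq_bigl => s; rewrite subsetD1 andbA.
rewrite -mulNr mulr_sumr.
rewrite (reindex_onto (fun h => v |: h) (fun h => h :\ v)) /=; last first.
  by move=> h /andP[_ jh]; rewrite setD1K.
apply: eq_big => [h|h /andP[_ /eqP hv]]; last first.
  have vh : v \notin h by rewrite -hv setD11.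
  by rewrite cardsU1 vh add1n exprS.
apply/idP/idP.
  case/andP=> /andP[/andP[vhK vhU] _] /eqP hv.
  have vh : v \notin h by rewrite -hv setD11.
  rewrite (hK.1 _ _ vhK (subsetUr _ _)) /=; apply/subsetP => w wh.
  have wvh : w \in v |: h by rewrite inE wh orbT.
  rewrite !inE (subsetP vhU w wvh) andbT; apply/andP; split.
    by apply: contraNneq vh => <-.
  by apply: hK.1 vhK _; apply/subsetP => x; rewrite !inE => /orP[->//|/eqP ->];
    rewrite wh orbT.
case/andP=> hin hlk; rewrite (flag_cone hin hlk) setU11 andbT /=.
have hU : h \subset U :\ v := subset_trans hlk (link_vertices_sub _ _).
have vh : v \notin h by move: hU; rewrite subsetD1 => /andP[].
by rewrite setU1K // eqxx andbT subUset sub1set vU (subset_trans hU) // subsetDl.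
Qed.

Lemma face_series0 U : face_series U 0%N = 1.
Proof.
rewrite coef_fps_sum (bigD1 set0) /=; last by rewrite K0 sub0set.
rewrite cards0 expr0 big1 => [|s /andP[_ s0]]; first by rewrite addr0.
have : (0 < #|s|)%N by rewrite card_gt0.
by case: #|s| => // j _; rewrite exprS coef_fpsM0 coef_fpsN /= oppr0 mul0r.
Qed.

Lemma face_series_set0 : face_series set0 = 1.
Proof.
rewrite /face_series (big_pred1 set0) ?cards0 // => s.
by rewrite subset0 /=; case: eqP => [->|]; rewrite ?K0 ?andbF.
Qed.

Lemma face_series_factor U v (H : fps int) : v \in U -> fps_nonneg H ->
  H * face_series (U :\ v) = face_series (link_vertices v (U :\ v)) ->
  exists B, [/\ fps_nonneg B, B 0%N = 0 &
    (1 + fps_mono 1) * face_series U = face_series (U :\ v) * (1 - B)].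
Proof.
move=> vU Hge HF.
have H0 : H 0%N = 1.
  have /(congr1 (fun a : fps int => a 0%N)) := HF.
  by rewrite coef_fpsM0 !face_series0 mulr1.
(* H - 1 is nonnegative because H has constant term 1. *)
exists (fps_mono 1 * (H - 1)); split.
- apply: fps_nonnegM; first exact: fps_nonneg_mono.
  case=> [|n]; first by rewrite coef_fpsD coef_fpsN H0 subrr.
  by rewrite coef_fpsD coef_fpsN coef_fps1 subr0.
- by rewrite coef_fpsM0 mul0r.
transitivity ((1 + fps_mono 1 - H * (fps_tdiv * (1 + fps_mono 1))) *
              face_series (U :\ v)); last by rewrite fps_tdivM; ring.
by rewrite (face_series_rec vU) -HF; ring.
Qed.

(** Remove v in U outside s. The induction hypothesis for the link gives B, and for s gives J = F_s
    / F_(U - v); the ratio is then J (1 + t) / (1 - B). *)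
Lemma face_series_ratio U s : s \subset U ->
  exists2 H, fps_nonneg H & H * face_series U = face_series s.
Proof.
have [c] := ubnP #|U|; elim: c => // c IHc in U s *; rewrite ltnS => Uc sU.
have [Us|] := boolP (U \subset s).
  exists 1; first exact: fps_nonneg1.
  by rewrite mul1r; congr face_series; apply/eqP; rewrite eqEsubset Us sU.
case/subsetPn=> v vU vs.
have Uvc : (#|U :\ v| < c)%N by move: Uc; rewrite (cardsD1 v) vU.
have [H Hge HF] := IHc (U :\ v) _ Uvc (link_vertices_sub v _).
have [B [Bge B0 BF]] := face_series_factor vU Hge HF.
have [|J Jge JF] := IHc (U :\ v) s Uvc; first by rewrite subsetD1 sU.
have := @fps_inverse _ (1 - B); rewrite coef_fpsD coef_fpsN B0 subr0 => /(_ erefl).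
set V := Fps _ => VB; have Vge : fps_nonneg V.
  by apply: fps_nonneg_inv1B Bge B0 _; rewrite mulrC.
exists (J * V * (1 + fps_mono 1)); last first.
  rewrite -mulrA BF; transitivity (J * face_series (U :\ v) * ((1 - B) * V)).
    by ring.
  by rewrite VB mulr1.
apply: fps_nonnegM; first exact: fps_nonnegM.
by apply: fps_nonnegD; [exact: fps_nonneg1 | exact: fps_nonneg_mono].
Qed.

Lemma pbw_rank_face_series N U : (0 < N)%N -> pbw_rank N (face_series U) <= 0.
Proof.
move=> N0; have [c] := ubnP #|U|; elim: c => // c IHc in U *; rewrite ltnS => Uc.
have [->|[v vU]] := set_0Vmem U; first by rewrite face_series_set0 pbw_rank1.
have /IHc IHv : (#|U :\ v| < c)%N by move: Uc; rewrite (cardsD1 v) vU.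
have [H Hge HF] := face_series_ratio (link_vertices_sub v (U :\ v)).
have [B [Bge B0 /(congr1 (pbw_rank N))]] := face_series_factor vU Hge HF.
rewrite !pbw_rankM ?face_series0 //; last first.
  by rewrite coef_fpsD coef_fpsN B0 subr0.
move=> E; have free := pbw_rank_free N0 Bge B0.
have one : 0 <= pbw_rank N (1 + fps_mono 1) by apply: pbw_rank_1Dmono.
rewrite -(lerD2l (pbw_rank N (1 + fps_mono 1))) E addr0.
by rewrite (le_trans (lerD IHv free)) // addr0.
Qed.

End FaceSeries.

(** * The sequences s and alpha *)

Section FVector.
Variables (m : nat) (K : {set {set 'I_m}}) (n : nat).
Hypotheses (hdim : complex_dim K n) (K0 : set0 \in K).

Lemma card_simplex s : s \in K -> (#|s| <= n.+1)%N.
Proof. by rewrite -hdim => sK; apply: (leq_bigmax_cond (F := fun t : {set 'I_m} => #|t|)). Qed.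

Lemma fvec_gt_dim i : (n < i)%N -> fvec K i = 0%N.
Proof.
move=> ni; apply/eqP; rewrite cards_eq0; apply/eqP/setP => s; rewrite !inE.
by apply/negP => /andP[/card_simplex sn /eqP si]; lia.
Qed.

Lemma face_seriesT :
  face_series K setT = 1 + \sum_(i < n.+1) (- fps_tdiv) ^+ i.+1 *+ fvec K i.
Proof.
(* [inord] is exact here, since simplices have at most n + 1 elements. *)
pose c (s : {set 'I_m}) : 'I_n.+2 := inord #|s|.
rewrite /face_series (eq_bigl (mem K)); last by move=> s; rewrite subsetT andbT.
have cE s j : s \in K -> (c s == j) = (#|s| == j).
  by move=> sK; rewrite -val_eqE /= inordK // ltnS card_simplex.
rewrite (partition_big c predT) //= big_ord_recl; congr (_ + _).
  rewrite (big_pred1 set0) ?cards0 // => s /=.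
  apply/andP/eqP => [[sK]|->]; last by rewrite cE // cards0.
  by rewrite cE //= cards_eq0 => /eqP.
apply: eq_bigr => i _; rewrite /fvec -sumr_const; apply: eq_big => [s|s /andP[sK]].
  by rewrite inE; case: (boolP (s \in K)) => //= sK; rewrite cE.
by rewrite cE // => /eqP ->.
Qed.

Let fps_of (p : {poly int}) : fps int := Fps (fps_poly p).

Let fps_ofM p q : fps_of (p * q) = fps_of p * fps_of q.
Proof. by apply: fpsP => k; rewrite coef_fpsM /= /fps_poly coefM. Qed.

Let fps_ofX p k : fps_of (p ^+ k) = fps_of p ^+ k.
Proof.
elim: k => [|k IHk]; last by rewrite !exprS fps_ofM IHk.
by apply: fpsP => k; rewrite !expr0 coef_fps1 /= /fps_poly coef1.
Qed.

Lemma fseriesE : Fps (fseries K n) = face_series K setT.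
Proof.
rewrite face_seriesT; apply: fpsP => k.
rewrite coef_fpsD coef_fps_sum /= /fseries {1}/fps_poly coef1; congr (_ + _).
apply: eq_bigr => i _.
set P := (1 + 'X) ^+ i.+1; set V := fps_inv _.
have fpsX1 : fps_of (1 + 'X) = 1 + fps_mono 1.
  by apply: fpsP => j; rewrite coef_fpsD /= /fps_poly coefD coef1 coefX.
have fpsX : fps_of 'X = fps_mono 1.
  by apply: fpsP => j; rewrite /= /fps_poly coefX.
have PV : fps_of P * Fps V = 1.
  by apply: fps_inverse; rewrite /= /fps_poly -horner_coef0 !hornerE expr1n.
have -> : fps_mul (fps_poly 'X^(i.+1)) V k = (fps_tdiv ^+ i.+1) k.
  rewrite -[LHS]/((fps_of 'X^(i.+1) * Fps V) k); congr (fps_coef _ k).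
  rewrite fps_ofX fpsX -fps_tdivM -fpsX1 exprMn -fps_ofX -/P.
  by rewrite -mulrA PV mulr1.
rewrite coef_fpsMn -mulr_natr natz (exprNn fps_tdiv) mulrAC; congr (_ * _).
rewrite -(signr_odd int) -(signr_odd (fps int)).
by case: odd; rewrite ?expr1 ?mulN1r ?expr0 ?mul1r.
Qed.

(** The series t / (1 - t), which is the twist of - t / (1 + t). *)
Let fps_geom : fps int := Fps (fun j => (0 < j)%N%:R).

Let fps_geomX i :
  fps_geom ^+ i.+1 = Fps (fun j => if j is j'.+1 then 'C(j', i)%:Z else 0).
Proof.
have geomE (a : fps int) : a * (1 - fps_mono 1) = a - fps_mono 1 * a by ring.
(* After multiplication by 1 - t, the induction step is Pascal's rule. *)
elim: i => [|i IHi]; first by apply: fpsP => -[|j] /=; rewrite ?bin0.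
apply: (@fps_mulIr _ _ _ (1 - fps_mono 1)) => //; rewrite exprSr -mulrA.
have -> : fps_geom * (1 - fps_mono 1) = fps_mono 1.
  by rewrite geomE; apply: fpsP => -[|[|j]]; rewrite coef_fpsD coef_fpsN coef_fps_monoM //=.
rewrite IHi mulrC geomE; apply: fpsP => -[|[|j]].
- by rewrite coef_fpsD coef_fpsN !coef_fps_monoM.
- by rewrite coef_fpsD coef_fpsN !coef_fps_monoM /= bin0n.
by rewrite coef_fpsD coef_fpsN !coef_fps_monoM /= binS PoszD addrAC subrr add0r.
Qed.

Lemma alpha_seriesE k :
  fps_twist (face_series K setT) k.+1 = (alpha K k.+1)%:Z.
Proof.
have twX i : fps_twist ((- fps_tdiv) ^+ i) = fps_geom ^+ i.
  elim: i => [|i IHi]; first by rewrite !expr0 fps_twist1.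
  rewrite !exprS fps_twistM IHi; congr (_ * _); apply: fpsP => -[|j].
    by rewrite coef_fps_twist coef_fpsN oppr0 mulr0.
  by rewrite coef_fps_twist coef_fpsN /= exprS mulN1r mulrNN -expr2 sqrr_sign.
rewrite face_seriesT coef_fps_twist coef_fpsD coef_fps1 add0r coef_fps_sum mulr_sumr.
pose F i := (fvec K i * 'C(k, i))%N.
transitivity ((\sum_(i < n.+1) F i)%N%:Z).
  rewrite -natz natr_sum; apply: eq_bigr => i _; rewrite natz /F.
  rewrite coef_fpsMn mulrnAr -coef_fps_twist twX fps_geomX /=.
  by rewrite PoszM mulrC -mulr_natr natz.
congr Posz; rewrite /alpha /= -!(big_mkord xpredT F).
(* The two ranges are padded to a common one: [F i] vanishes for i > n through the f-vector and for
   i > k through the binomial. *)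
have widen a b : (forall i, (a <= i)%N -> F i = 0%N) ->
    (\sum_(0 <= i < a) F i = \sum_(0 <= i < a + b) F i)%N.
  move=> Fz; rewrite [RHS](@big_cat_nat _ _ _ a) ?leq_addr //=.
  rewrite [X in (_ = _ + X)%N]big_nat_cond [X in (_ = _ + X)%N]big1 ?addn0 //.
  by move=> i /andP[/andP[ai _] _]; apply: Fz.
rewrite (widen n.+1 k.+1) => [|i ni]; last by rewrite /F fvec_gt_dim.
by rewrite addnC -widen // => i ki; rewrite /F bin_small ?muln0.
Qed.

End FVector.

Set Printing Implicit Defensive.
Set Strict Implicit.
Unset Implicit Arguments.

Theorem mainTheorem4 (m : nat) (K : {set {set 'I_m}}) (n : nat)
    (hK : simplicial_complex K) (hflag : flag K) (hdim : complex_dim K n)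
    (N : nat) (hN : (1 <= N)%N) :
  0 <= (-1) ^+ N.+1 *
       \sum_(d <- divisors N) mobius (N %/ d) * psum d (sseq K n)
  /\
  0 <= (-1) ^+ N *
       \sum_(d <- divisors N) mobius (N %/ d) * (-1) ^+ d *
         psum d (fun k => (alpha K k)%:Z).
Proof.
have K0 : set0 \in K.
  (* An empty K would have maximum 0 instead of n + 1. *)
  have /set0Pn[s sK] : K != set0.
    by apply/eqP => KE; move: hdim; rewrite /complex_dim KE big_set0.
  exact: hK.1 sK (sub0set s).
set F := face_series K setT; have F0 : F 0%N = 1 by apply: face_series0.
pose S : fps int := Fps (sseq K n); have S0 : S 0%N = 1 by apply: sseq0.
have FS : F * S = 1.
  by rewrite /F -(fseriesE hdim K0); apply: fps_inverse; apply: fseries0.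
have SF : psum_series S = - psum_series F.
  by apply/eqP; rewrite -addr_eq0 addrC -psum_seriesM // FS psum_series1.
have rank_ge0 : 0 <= pbw_rank N S.
  have /(congr1 (pbw_rank N)) := FS; rewrite pbw_rankM // pbw_rank1 => /eqP.
  rewrite addrC addr_eq0 => /eqP ->; rewrite oppr_ge0.
  exact: pbw_rank_face_series.
split; first by rewrite -[X in 0 <= X](pbw_rankE hN S).
congr (0 <= _): rank_ge0; congr (_ * _).
rewrite big_seq [RHS]big_seq; apply: eq_bigr => d; rewrite -dvdn_divisors // => dN.
have d0 := dvdn_gt0 hN dN; rewrite -!mulrA; congr (_ * _).
(* The two sequences differ at index 0, which [psum] ignores. *)
have -> : psum d (fun k => (alpha K k)%:Z) = psum d (fps_twist F).
  by apply: psum_eq => -[|i] // _; rewrite (alpha_seriesE hdim K0).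
rewrite SF coef_fpsN mulrN -coef_fps_twist -psum_series_twist //.
by case: d d0 {dN} => // d _; rewrite /= exprS mulN1r mulNr opprK.
Qed.
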